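(* Let $U\subset\mathbb{R}^N$ be a neighborhood of the origin and let $(U,d)$ be a quasimetric space that has a $\delta_\varepsilon$-homogeneous approximation. Let $\Phi:U\to\Phi(U)\subset\mathbb{R}^N$ be a homeomorphism with $\Phi(0)=0$. Define a quasimetric $\rho$ on $\Phi(U)$ by $$\rho(u,v)=d(\Phi^{-1}(u),\Phi^{-1}(v)).$$ If the quasimetric space $(\Phi(U),\rho)$ has a $\delta_\varepsilon$-homogeneous approximation, then there are $\varepsilon_0>0$ and $0<C_1\le C_2<\infty$ such that $$\mathrm{Box}(C_1\varepsilon)\subset\Phi(\mathrm{Box}(\varepsilon))\subset\mathrm{Box}(C_2\varepsilon)$$ for all $\varepsilon\in(0,\varepsilon_0)$.
   Context: A quasimetric on a neighborhood $U\subset\mathbb{R}^N$ of the origin is a continuous function $d:U\times U\to\mathbb{R}$ such that: $d(x,y)\ge 0$, with $d(x,y)=0$ iff $x=y$; $d(x,y)\le C\,d(y,x)$ for all $x,y\in U$ and some constant $C\ge1$; $d(x,z)\le Q(d(x,y)+d(y,z))$ for all $x,y,z\in U$ and some constant $Q\ge1$. The pair $(U,d)$ is called a quasimetric space. Fix a tuple $(\sigma_1,\dots,\sigma_N)$ of positive real numbers. For $\varepsilon>0$ set $\delta_\varepsilon(x_1,\dots,x_N)=(\varepsilon^{\sigma_1}x_1,\dots,\varepsilon^{\sigma_N}x_N)$. Set $\|x\|=\max_{k}|x_k|^{1/\sigma_k}$ and $\mathrm{Box}(r)=\{x\in\mathbb{R}^N:\|x\|<r\}$. A quasimetric $\widehat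 d$ on $\mathbb{R}^N$ is $\delta_\varepsilon$-homogeneous if $\widehat d(\delta_\varepsilon x,\delta_\varepsilon y)=\varepsilon\,\widehat d(x,y)$ for all $x,y\in\mathbb{R}^N$, $\varepsilon>0$. The quasimetric space $(U,d)$ has a $\delta_\varepsilon$-homogeneous approximation if there is a $\delta_\varepsilon$-homogeneous quasimetric $\widehat d$ on $\mathbb{R}^N$ such that $\lim_{\varepsilon\to0}\frac1\varepsilon d(\delta_\varepsilon x,\delta_\varepsilon y)=\widehat d(x,y)$ uniformly for $x,y$ in some neighborhood of the origin; then $\widehat d$ is called the $\delta_\varepsilon$-homogeneous approximation of $d$. *)

(* Defs.v *)
From HB Require Import structures.
From mathcomp Require Import all_boot all_order all_algebra.
From mathcomp Require Import all_classical all_reals all_analysis.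
Set Implicit Arguments.
Unset Strict Implicit.
Unset Printing Implicit Defensive.
Import Order.TTheory GRing.Theory Num.Theory.
Import numFieldNormedType.Exports.
Local Open Scope classical_set_scope.
Local Open Scope ring_scope.

Section Quasimetric.
Variables (R : realType) (N : nat).
Implicit Types (U : set 'rV[R]_N) (d : 'rV[R]_N -> 'rV[R]_N -> R).

(* A function on U x U is represented by a total function d, of which only
   the values on U x U matter. *)
Definition is_quasimetric U d : Prop :=
  [/\ {within U `*` U, continuous (fun p => d p.1 p.2)},
      forall x y, U x -> U y -> 0 <= d x y /\ (d x y = 0 <-> x = y),
      exists2 C : R, 1 <= C & forall x y, U x -> U y -> d x y <= C * d y x
    & exists2 Q : R, 1 <= Q &
        forall x y z, U x -> U y -> U z -> d x z <= Q * (d x y + d y z)].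

Variable sigma : 'I_N -> R.

Definition dil (e : R) (x : 'rV[R]_N) : 'rV[R]_N :=
  \row_i (e `^ sigma i * x ord0 i).

Definition hnorm (x : 'rV[R]_N) : R :=
  \big[Num.max/0]_(i < N) `|x ord0 i| `^ (sigma i)^-1.

Definition Box (r : R) : set 'rV[R]_N := [set x | hnorm x < r].

Definition dil_homogeneous d : Prop :=
  forall (e : R) x y, 0 < e -> d (dil e x) (dil e y) = e * d x y.

(* The condition dil e @` V `<=` U expresses that d (dil e x) (dil e y) is
   defined for all x, y in V: only the values of d on U x U are meaningful.
   When U is a neighborhood of 0, it holds for every bounded V. *)
Definition is_homogeneous_approximation U d dhat : Prop :=
  [/\ is_quasimetric setT dhat,
      dil_homogeneous dhat
    & exists V : set 'rV[R]_N,
      [/\ nbhs (0 : 'rV[R]_N) V,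
          \forall e \near 0^'+, dil e @` V `<=` U
        & {uniform V `*` V,
            (fun (e : R) (p : 'rV[R]_N * 'rV[R]_N) =>
               e^-1 * d (dil e p.1) (dil e p.2)) @ 0^'+
            --> (fun p => dhat p.1 p.2)}]].

Definition has_homogeneous_approximation U d : Prop :=
  exists dhat, is_homogeneous_approximation U d dhat.

(* Phi restricts to a homeomorphism from U onto its image Phi @` U, with
   inverse the restriction of Psi to Phi @` U. *)
Definition is_homeomorphism_onto_image U (Phi Psi : 'rV[R]_N -> 'rV[R]_N)
    : Prop :=
  [/\ forall x, U x -> Psi (Phi x) = x,
      {within U, continuous Phi}
    & {within Phi @` U, continuous Psi}].

End Quasimetric.

(* Main.v *)
(** The homogeneous limit of [d] is bounded above and below by positive constants
    on the compact sphere [||w|| = 1], so by homogeneity and uniform convergence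
    [d x 0] is comparable to [||x||] near 0. The same holds for [rho u 0] and
    [||u||]; since [rho (Phi x) 0 = d x 0], continuity of [Phi] and its inverse
    at 0 makes [||Phi x||] and [||x||] comparable. *)
Require Import Defs.
From HB Require Import structures.
From mathcomp Require Import all_boot all_order all_algebra.
From mathcomp Require Import all_classical all_reals all_analysis.
From mathcomp Require Import lra.
Import Order.TTheory GRing.Theory Num.Theory.
Import numFieldNormedType.Exports.
Local Open Scope classical_set_scope.
Local Open Scope ring_scope.

(** * Real powers with inverse exponents *)

Section PowR.
Set Implicit Arguments.
Unset Strict Implicit.
Variable R : realType.
Implicit Types a r s : R.

Lemma powRKV s a : s != 0 -> 0 <= a -> (a `^ s) `^ s^-1 = a.
Proof. by move=> s0 a0; rewrite -powRrM mulfV// powRr1. Qed.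

Lemma powRVK s a : s != 0 -> 0 <= a -> (a `^ s^-1) `^ s = a.
Proof. by move=> s0 a0; rewrite -powRrM mulVf// powRr1. Qed.

Lemma powRV_lt s a r : 0 < s -> 0 <= a -> 0 <= r ->
  (a `^ s^-1 < r) = (a < r `^ s).
Proof.
move=> s0 a0 r0; have sN0 := lt0r_neq0 s0; apply/idP/idP => [ar|ar].
  rewrite -(powRVK sN0 a0); apply: gt0_ltr_powR => //.
  by rewrite nnegrE powR_ge0.
rewrite -(powRKV sN0 r0); apply: gt0_ltr_powR; rewrite ?invr_gt0//.
by rewrite nnegrE powR_ge0.
Qed.

(** Negation of the strict version at the exponent [s^-1], with the roles of [a] and [r]
    exchanged. *)
Lemma powRV_le s a r : 0 < s -> 0 <= a -> 0 <= r ->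
  (a `^ s^-1 <= r) = (a <= r `^ s).
Proof.
by move=> s0 a0 r0; rewrite !leNgt -{2}(invrK s) powRV_lt ?invr_gt0.
Qed.

End PowR.

(** * Homogeneous norm, dilations and boxes *)

Section HomogeneousNorm.
Set Implicit Arguments.
Unset Strict Implicit.
Variables (R : realType) (N : nat) (sigma : 'I_N -> R).
Hypothesis sigma_gt0 : forall i, 0 < sigma i.
Implicit Types (x y : 'rV[R]_N) (r e : R).

Notation hnorm := (hnorm sigma).
Notation dil := (dil sigma).
Notation Box := (Box sigma).

Lemma hnorm_ge0 x : 0 <= hnorm x.
Proof. exact: bigmax_ge_id. Qed.

(** Makes [Box r] a product of intervals of half-widths [r ^ sigma i]. The maximum starts from 0, so
    the strict bound asks for [0 < r]. *)
Lemma hnorm_ltP x r : 0 < r ->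
  hnorm x < r <-> forall i, `|x ord0 i| < r `^ sigma i.
Proof.
move=> r0; split=> [/bigmax_ltP[_ xr] i|xr].
  by rewrite -powRV_lt ?xr// ltW.
by apply/bigmax_ltP; split=> // i _; rewrite powRV_lt// ltW.
Qed.

Lemma hnorm_leP x r : 0 <= r ->
  hnorm x <= r <-> forall i, `|x ord0 i| <= r `^ sigma i.
Proof.
move=> r0; split=> [/bigmax_leP[_ xr] i|xr].
  by rewrite -powRV_le ?xr.
by apply/bigmax_leP; split=> // i _; rewrite powRV_le.
Qed.

Lemma hnorm_eq0 x : hnorm x = 0 -> x = 0.
Proof.
move=> x0; apply/rowP => i; rewrite mxE; apply/eqP; rewrite -normr_le0.
have /hnorm_leP : hnorm x <= 0 by rewrite x0.
by move=> /(_ (lexx _) i); rewrite powR0// gt_eqF.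
Qed.

Lemma hnorm0 : hnorm 0 = 0.
Proof.
apply/eqP; rewrite eq_le hnorm_ge0 andbT; apply/hnorm_leP => // i.
by rewrite mxE normr0 powR_ge0.
Qed.

Lemma hnorm_dil e x : 0 < e -> hnorm (dil e x) = e * hnorm x.
Proof.
move=> e0; rewrite /hnorm /Defs.hnorm.
elim/big_rec2: _ => [|i y z _ ->]; first by rewrite mulr0.
rewrite maxr_pMr ?ltW//; congr Num.max.
rewrite mxE normrM ger0_norm ?powR_ge0// powRM ?powR_ge0//.
by rewrite powRKV ?ltW// gt_eqF.
Qed.

Lemma dil0 e : dil e 0 = 0.
Proof. by apply/rowP => i; rewrite !mxE mulr0. Qed.

Lemma dil1 x : dil 1 x = x.
Proof. by apply/rowP => i; rewrite mxE powR1 mul1r. Qed.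

Lemma dilM e r x : 0 <= e -> 0 <= r -> dil e (dil r x) = dil (e * r) x.
Proof. by move=> e0 r0; apply/rowP => i; rewrite !mxE powRM// mulrA. Qed.

Lemma nbhs0_Box r : 0 < r -> nbhs (0 : 'rV[R]_N) (Box r).
Proof.
move=> r0.
have xr i : \forall x \near nbhs (0 : 'rV[R]_N), `|(x : 'rV[R]_N) ord0 i| < r `^ sigma i.
  apply/nbhs_ballP; exists (r `^ sigma i) => /=; first exact: powR_gt0.
  by move=> x [_ /(_ ord0 i)]; rewrite /ball/= !mxE sub0r normrN.
by apply: filterS (filter_forall _ xr) => x /= /hnorm_ltP; exact.
Qed.

(** Each [r ^ sigma i] tends to 0 with [r], and there are finitely many coordinates, so one [r] fits
    the box into a max-norm ball. *)
Lemma Box_sub_nbhs0 (V : set 'rV[R]_N) : nbhs (0 : 'rV[R]_N) V ->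
  exists2 r, 0 < r & Box r `<=` V.
Proof.
move=> /nbhs_ballP[e /= e0 eV].
have re i : \forall r \near 0^'+, r `^ sigma i < e.
  have /cvgrPdist_lt/(_ e e0) := powR_cvg0 (sigma_gt0 i).
  by apply: filterS => r /=; rewrite sub0r normrN ger0_norm// powR_ge0.
have [r [r0 {}re]] : exists r, 0 < r /\ forall i, r `^ sigma i < e.
  apply: (@filter_ex _ (0 : R)^'+).
  by apply: filterI; [exact: nbhs_right_gt | exact: (filter_forall _ re)].
exists r => // x /hnorm_ltP => /(_ r0) xr; apply: eV; split=> // i j.
rewrite (ord1 i) /ball/= !mxE sub0r normrN.
exact: lt_trans (xr j) (re j).
Qed.

(** Every power of 1 is 1, so at the threshold 1 both norms compare the same coordinates with 1. The
    homogeneous unit sphere thus inherits compactness from the max-norm sphere. *)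
Lemma hnorm_eq1 x : (hnorm x == 1) = (`|x| == 1).
Proof.
have hle : (hnorm x <= 1) = (`|x| <= 1).
  apply/idP/idP => [/(hnorm_leP _ ler01) x1|].
    rewrite [leLHS]mx_normrE; apply/bigmax_leP; split=> // -[i j] _ /=.
    by rewrite (ord1 i) (le_trans (x1 j))// powR1.
  rewrite [leLHS]mx_normrE => /bigmax_leP[_ x1].
  by apply/hnorm_leP => // i; rewrite powR1; exact: (x1 (ord0, i)).
have hlt : (hnorm x < 1) = (`|x| < 1).
  apply/idP/idP => [/(hnorm_ltP _ ltr01) x1|].
    rewrite [ltLHS]mx_normrE; apply/bigmax_ltP; split=> // -[i j] _ /=.
    by rewrite (ord1 i) (lt_le_trans (x1 j))// powR1.
  rewrite [ltLHS]mx_normrE => /bigmax_ltP[_ x1].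
  by apply/hnorm_ltP => // i; rewrite powR1; exact: (x1 (ord0, i)).
by rewrite !eq_le ![1 <= _]leNgt hle hlt.
Qed.

Lemma compact_hsphere : compact [set x | hnorm x = 1].
Proof.
have -> : [set x | hnorm x = 1] = [set x | `|x| = 1].
  by apply/seteqP; split=> x /= /eqP;
    [rewrite hnorm_eq1 => /eqP | rewrite -hnorm_eq1 => /eqP].
apply: bounded_closed_compact.
  exists 1; split; first exact: num_real.
  by move=> M M1 x /= ->; exact: ltW.
rewrite -[X in closed X]/(Num.norm @^-1` [set r : R | r = 1]).
apply: preimage_closed; last exact: closed_eq.
by move=> x _; exact: norm_continuous.
Qed.

Lemma hnorm_polar x : 0 < hnorm x ->
  exists2 w, hnorm w = 1 & x = dil (hnorm x) w.
Proof.
move=> x0; have xV0 : 0 < (hnorm x)^-1 by rewrite invr_gt0.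
exists (dil (hnorm x)^-1 x); first by rewrite hnorm_dil// mulVf// gt_eqF.
by rewrite dilM ?ltW// mulfV ?gt_eqF// dil1.
Qed.

(** * Comparison of a quasimetric with the homogeneous norm *)

Lemma continuous_bounds_hsphere (f : 'rV[R]_N -> R) : continuous f ->
  (forall x, x != 0 -> 0 < f x) ->
  exists m M, [/\ 0 < m, 0 < M
    & forall w, hnorm w = 1 -> m <= f w <= M].
Proof.
move=> cf f0; have [S0|/set0P/negP] := pselect ([set x | hnorm x = 1] !=set0).
  have cS := continuous_subspaceT cf.
  have [c /[!inE]/= c1 cmin] := compact_EVT_min S0 compact_hsphere (cS _).
  have [b /[!inE]/= b1 bmax] := compact_EVT_max S0 compact_hsphere (cS _).
  have sphere_neq0 w : hnorm w = 1 -> w != 0.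
    move=> w1; apply: contra_eq_neq w1 => ->.
    by rewrite hnorm0 eq_sym oner_neq0.
  exists (f c), (f b); split; [exact/f0/sphere_neq0.. |] => w w1.
  by rewrite cmin ?inE// bmax ?inE.
(* The sphere is empty when [N] is 0; any positive constants then do. *)
rewrite negbK => /eqP S0; exists 1, 1; split=> // w w1.
by have : set0 w by rewrite -S0.
Qed.

(** [U] contains [dil e @] V[for some]e > 0[, hence a dilated box, which is again a box. Applied
    to]Phi @[U], this replaces an appeal to invariance of domain. *)
Lemma approximation_nbhs0 (U : set 'rV[R]_N) d :
  has_homogeneous_approximation sigma U d -> nbhs (0 : 'rV[R]_N) U.
Proof.
move=> [dh [_ _ [V [/Box_sub_nbhs0[r r0 rV] VU _]]]].
have [e [e0 eVU]] : exists e, 0 < e /\ dil e @` V `<=` U.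
  apply: (@filter_ex _ (0 : R)^'+).
  by apply: filterI; [exact: nbhs_right_gt | exact: VU].
apply: filterS (nbhs0_Box (mulr_gt0 e0 r0)) => x xer; apply: eVU.
have eV0 : 0 < e^-1 by rewrite invr_gt0.
exists (dil e^-1 x); last by rewrite dilM ?ltW// mulfV ?gt_eqF// dil1.
by apply: rV; rewrite /Box/= hnorm_dil// mulrC ltr_pdivrMr// mulrC.
Qed.

Lemma approximation_hnorm (U : set 'rV[R]_N) d : d 0 0 = 0 ->
  has_homogeneous_approximation sigma U d ->
  exists m M, [/\ 0 < m, 0 < M
    & \forall x \near (0 : 'rV[R]_N), m * hnorm x <= d x 0 <= M * hnorm x].
Proof.
move=> d00 [dh [[dh_cont dh_pos _ _] dhD]].
move=> [V [/Box_sub_nbhs0[r r0 rV] _ unif]].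
have dh_cont0 : continuous (dh ^~ 0).
  move: dh_cont; rewrite setXTT -continuous_subspace_setT => dh_cont x.
  pose pair0 (y : 'rV[R]_N) := (y, 0 : 'rV[R]_N).
  rewrite -[dh ^~ 0]/((fun p => dh p.1 p.2) \o pair0).
  apply: continuous_comp.
    exact: (@cvg_pair _ _ _ (nbhs x) (nbhs x) (nbhs (0 : 'rV[R]_N)) _ _ _
      id (cst 0) cvg_id (cvg_cst _)).
  exact: dh_cont.
have dh_gt0 x : x != 0 -> 0 < dh x 0.
  move=> x0; have [dh0 [dheq _]] := dh_pos x 0 Logic.I Logic.I.
  by rewrite lt_neqAle dh0 andbT eq_sym; apply: contra_neq x0.
have [m [M [m0 M0 mM]]] := continuous_bounds_hsphere dh_cont0 dh_gt0.
(* The unit sphere may leave [V], where convergence is uniform; the sphere of radius [s] lies in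
   [Box r], hence in [V]. *)
pose s := r / 2; have s0 : 0 < s by rewrite divr_gt0.
have sr : s < r by rewrite ltr_pdivrMr// ltr_pMr// ltr1n.
have m20 : 0 < m / 2 by rewrite divr_gt0.
have sm : 0 < s * (m / 2) by rewrite mulr_gt0.
have V0 : V 0 by apply: rV; rewrite /Box/= hnorm0.
(* The tolerance is half of [s * m], a lower bound of [dh ^~ 0] on the sphere of radius [s], so the
   limit stays bounded away from 0 after the perturbation. *)
have : \forall e \near 0^'+, forall w, hnorm w = 1 ->
    `|dh (dil s w) 0 - e^-1 * d (dil e (dil s w)) 0| < s * (m / 2).
  pose E := [set p : R * R | `|p.1 - p.2| < s * (m / 2)].
  have entE : entourage E := entourage_ball R (PosNum sm).
  have : \forall e \near 0^'+, forall p, (V `*` V) p ->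
      E (dh p.1 p.2, e^-1 * d (dil e p.1) (dil e p.2)).
    apply: (unif [set h | forall p, (V `*` V) p -> E (dh p.1 p.2, h p)]).
    by apply: (uniform_nbhs _ _).2; exists E; split.
  apply: filterS => e /= H w w1.
  have Vw : V (dil s w) by apply: rV; rewrite /Box/= hnorm_dil// w1 mulr1.
  by have := H (dil s w, 0) (conj Vw V0); rewrite /E/= dil0.
rewrite near_withinE => /nbhs_ballP[del /= del0 Hdel].
exists (m / 2), (M + m / 2); split; [by []|exact: addr_gt0|].
(* On [Box (s * del)] the scale [e = hnorm x / s] used below is less than [del]. The origin, where
   this scale vanishes, is treated apart. *)
apply: filterS (nbhs0_Box (mulr_gt0 s0 del0)) => x /= xs.
have [x0|x0] := eqVneq (hnorm x) 0.
  by rewrite x0 (hnorm_eq0 x0) d00 !mulr0 lexx.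
have {}x0 : 0 < hnorm x by rewrite lt_neqAle eq_sym x0 hnorm_ge0.
have [w w1 xw] := hnorm_polar x0.
pose e := hnorm x / s; have e0 : 0 < e by rewrite divr_gt0.
have es : e * s = hnorm x by rewrite divfK// gt_eqF.
have xE : x = dil e (dil s w) by rewrite dilM ?ltW// es.
have : ball 0 del e.
  by rewrite /ball/= sub0r normrN gtr0_norm// ltr_pdivrMr// mulrC.
move=> /Hdel/(_ e0)/(_ w w1); rewrite -xE -{1}(dil0 s) dhD//.
rewrite ltr_distlC; set D := e^-1 * d x 0 => /andP[D1 D2].
have /andP[mw wM] := mM _ w1.
(* [D] is within [s * (m / 2)] of [s * dh w 0], which lies between [s * m] and [s * M]; multiplying
   by [e] turns [s] into [hnorm x]. *)
have -> : d x 0 = e * D by rewrite mulrA mulfV ?mul1r// gt_eqF.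
have smw := ler_wpM2l (ltW s0) mw.
have swM := ler_wpM2l (ltW s0) wM.
rewrite -es ![_ * (e * s)]mulrCA !ler_pM2l//; apply/andP; split; lra.
Qed.

End HomogeneousNorm.

(** * Box inclusions for the homeomorphism *)

Theorem theorem4 (R : realType) (N : nat) (sigma : 'I_N -> R)
    (sigma_gt0 : forall i, 0 < sigma i)
    (U : set 'rV[R]_N) (U_nbhs : nbhs (0 : 'rV[R]_N) U)
    (d : 'rV[R]_N -> 'rV[R]_N -> R) (d_quasimetric : is_quasimetric U d)
    (d_approx : has_homogeneous_approximation sigma U d)
    (Phi Psi : 'rV[R]_N -> 'rV[R]_N)
    (Phi_homeo : is_homeomorphism_onto_image U Phi Psi)
    (Phi0 : Phi 0 = 0)
    (rho_approx : has_homogeneous_approximation sigma (Phi @` U)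
       (fun u v => d (Psi u) (Psi v))) :
  exists e0 C1 C2 : R,
    [/\ 0 < e0, 0 < C1, C1 <= C2
      & forall e : R, 0 < e -> e < e0 ->
          Box sigma (C1 * e) `<=` Phi @` Box sigma e /\
          Phi @` Box sigma e `<=` Box sigma (C2 * e)].
Proof.
have [PhiK Phi_cont Psi_cont] := Phi_homeo.
have U0 : U 0 := nbhs_singleton U_nbhs.
have Psi0 : Psi 0 = 0 by rewrite -{1}Phi0 PhiK.
have PU_nbhs := approximation_nbhs0 sigma_gt0 rho_approx.
have d00 : d 0 0 = 0.
  by case: d_quasimetric => _ /(_ 0 0 U0 U0)[_ [_ ->]].
have [a [A [a0 A0 daA]]] := approximation_hnorm sigma_gt0 d00 d_approx.
have := approximation_hnorm sigma_gt0 _ rho_approx.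
rewrite /= Psi0 => /(_ d00)[b [B [b0 B0 rbB]]].
have cvg_Phi : Phi x @[x --> (0 : 'rV[R]_N)] --> (0 : 'rV[R]_N).
  move/subspace_continuousP : Phi_cont => /(_ 0 U0).
  by rewrite /from_subspace Phi0 (within_interior U_nbhs).
have cvg_Psi : Psi x @[x --> (0 : 'rV[R]_N)] --> (0 : 'rV[R]_N).
  move/subspace_continuousP : Psi_cont => /(_ 0 (nbhs_singleton PU_nbhs)).
  by rewrite /from_subspace Psi0 (within_interior PU_nbhs).
(* The middle term of the chain is [d x 0], which is also the distance from [Phi x] to 0 for the
   transported quasimetric. *)
have [r1 r10 r1P] : exists2 r, 0 < r & Box sigma r `<=` [set x |
    b * hnorm sigma (Phi x) <= A * hnorm sigma x].
  apply: Box_sub_nbhs0 => //.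
  move: U_nbhs daA (cvg_Phi _ rbB); apply: filterS3 => x Ux /andP[_ dA] /=.
  by rewrite PhiK// => /andP[/le_trans + _]; exact.
have [r2 r20 r2P] : exists2 r, 0 < r & Box sigma r `<=` [set u |
    (Phi @` U) u /\ a * hnorm sigma (Psi u) <= B * hnorm sigma u].
  apply: Box_sub_nbhs0 => //.
  move: PU_nbhs rbB (cvg_Psi _ daA); apply: filterS3 => u PUu /andP[_ dB] /=.
  by move=> /andP[/le_trans dPsi _]; split=> //; exact: dPsi.
(* The ratios come from the two chains. Truncating at 1 gives [C1 <= C2], and [C1 <= 1] keeps
   [Box (C1 * e)] inside [Box r2]. *)
exists (Num.min r1 r2), (Num.min 1 (a / B)), (Num.max 1 (A / b)); split.
- by rewrite lt_min r10.
- by rewrite lt_min ltr01 divr_gt0.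
- by rewrite ge_min le_max lexx.
move=> e e0; rewrite lt_min => /andP[er1 er2]; split=> [u uC|_ [x xe <-]].
  have /r2P[[x Ux xu] auB] : Box sigma r2 u.
    apply: lt_trans er2; apply: lt_le_trans uC _.
    by rewrite ger_pMl// ge_min lexx.
  exists x => //; rewrite /Box/= -(PhiK x Ux) xu -(ltr_pM2l a0).
  apply: le_lt_trans auB _.
  rewrite -ltr_pdivlMl// mulrA [_^-1 * _]mulrC.
  by apply: lt_le_trans uC _; rewrite ler_pM2r// ge_min lexx orbT.
have bxA := r1P x (lt_trans xe er1).
rewrite /Box/= -(ltr_pM2l b0); apply: le_lt_trans bxA _.
have Axe : A * hnorm sigma x < A * e by rewrite ltr_pM2l.
apply: lt_le_trans Axe _.
by rewrite mulrA ler_pM2r// -ler_pdivrMl// [_^-1 * _]mulrC le_max lexx orbT.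
Qed.
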